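(* Let $d\ge 1$, $\eta>0$, $\sigma>1$, $\alpha\ge 1$, and let $0<\epsilon<\eta$. Consider the distribution $\mathcal{D}$ on $\mathbb{R}^d\times\{-1,+1\}$ given by $y$ uniform on $\{-1,+1\}$, $\bm{\mu}=(\eta,\dots,\eta)\in\mathbb{R}^d$, and $\bm{x}\mid y=+1\sim\mathcal{N}(\bm{\mu},\sigma^2 I)$, $\bm{x}\mid y=-1\sim\mathcal{N}(-\alpha\bm{\mu}, I)$. Consider linear classifiers $f(\bm{x})=\operatorname{sign}(\bm{w}^\top\bm{x}+b)$ with $\bm{w}\in\mathbb{R}^d$, $\|\bm{w}\|_2=1$, $b\in\mathbb{R}$. Define the standard error $\mathcal{R}_{nat}(f)=\Pr(f(\bm{x})\neq y)$, the robust error $\mathcal{R}_{rob}(f)=\Pr(\exists\,\bm{\delta},\ \|\bm{\delta}\|_\infty\le\epsilon:\ f(\bm{x}+\bm{\delta})\neq y)$, and the class-conditional errors $\mathcal{R}_{nat}(f\mid y)$, $\mathcal{R}_{rob}(f\mid y)$ obtained by conditioning on the label. Let $f_{nat}$ minimize $\mathcal{R}_{nat}$ and $f_{rob}$ minimize $\mathcal{R}_{rob}$ over $(\bm{w},b)$, and let $A=\frac{2\sqrt{d}\,\sigma}{\sigma^2-1}>0$. Then $$\mathcal{R}_{nat}(f_{nat}\mid +1)=\Pr\Big(\mathcal{N}(0,1)<-A\big(\tfrac{1+\alpha}{2}\eta\big)+\sqrt{\big(\tfrac{A}{\sigma}\big)^2\big(\tfrac{1+\alpha}{2}\eta\big)^2+\tfrac{2\log\sigma}{\sigma^2-1}}\Big),$$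 $$\mathcal{R}_{rob}(f_{rob}\mid +1)=\Pr\Big(\mathcal{N}(0,1)<-A\big(\tfrac{1+\alpha}{2}\eta-\epsilon\big)+\sqrt{\big(\tfrac{A}{\sigma}\big)^2\big(\tfrac{1+\alpha}{2}\eta-\epsilon\big)^2+\tfrac{2\log\sigma}{\sigma^2-1}}\Big),$$ and consequently both $\mathcal{R}_{nat}(f_{nat}\mid +1)$ and $\mathcal{R}_{rob}(f_{rob}\mid +1)$ are monotonically decreasing functions of $\alpha$.
   Context: $\Pr(\mathcal{N}(0,1)<z)$ denotes the standard normal cumulative distribution function evaluated at $z$. $I$ is the $d\times d$ identity matrix. *)

(* Defs.v *)
From HB Require Import structures.
From mathcomp Require Import all_boot all_order all_algebra.
From mathcomp Require Import all_classical all_reals all_analysis.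
Set Implicit Arguments. Unset Strict Implicit. Unset Printing Implicit Defensive.
Import Order.TTheory GRing.Theory Num.Theory.
Local Open Scope classical_set_scope.
Local Open Scope ring_scope.

Section defs.
Context {R : realType} {d : nat}.

Definition dotv (w x : 'rV[R]_d) : R := \sum_(i < d) w ord0 i * x ord0 i.
Definition norm2 (w : 'rV[R]_d) : R := Num.sqrt (\sum_(i < d) w ord0 i ^+ 2).
Definition linf_le (eps : R) (delta : 'rV[R]_d) : Prop :=
  forall i, `|delta ord0 i| <= eps.
(* sign, with the convention sign 0 = +1 (a null event here) *)
Definition sgn (t : R) : R := if 0 <= t then 1 else -1.
Definition clf (w : 'rV[R]_d) (b : R) (x : 'rV[R]_d) : R := sgn (dotv w x + b).
Definition muv (eta : R) : 'rV[R]_d := \row_(i < d) eta.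
End defs.

Definition std_gaussian_vector {R : realType} (dT : measure_display)
  (T : measurableType dT) (P : probability T R) (d : nat)
  (Z : 'I_d -> {RV P >-> R}) : Prop :=
  (forall i (A : set R), measurable A -> P (Z i @^-1` A) = normal_prob 0 1 A) /\
  (forall B : 'I_d -> set R, (forall i, measurable (B i)) ->
     P [set om | forall i, B i (Z i om)] = (\prod_(i < d) P (Z i @^-1` B i))%E).

Section model.
Context {R : realType} {dT : measure_display} {T : measurableType dT}
  (P : probability T R) {d : nat} (Z : 'I_d -> {RV P >-> R}).
Variables (eta sigma alpha eps : R).

(* x | y = +1  ~  N(mu, sigma^2 I)  realized as mu + sigma Z *)
Definition xplus (om : T) : 'rV[R]_d := muv eta + sigma *: \row_i Z i om.
(* x | y = -1  ~  N(-alpha mu, I)  realized as -alpha mu + Z *)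
Definition xminus (om : T) : 'rV[R]_d := - (alpha *: muv eta) + \row_i Z i om.

Definition Rnat_pos (w : 'rV[R]_d) (b : R) : \bar R :=
  P [set om | clf w b (xplus om) != 1].
Definition Rnat_neg (w : 'rV[R]_d) (b : R) : \bar R :=
  P [set om | clf w b (xminus om) != -1].
Definition Rrob_pos (w : 'rV[R]_d) (b : R) : \bar R :=
  P [set om | exists delta, linf_le eps delta /\ clf w b (xplus om + delta) != 1].
Definition Rrob_neg (w : 'rV[R]_d) (b : R) : \bar R :=
  P [set om | exists delta, linf_le eps delta /\ clf w b (xminus om + delta) != -1].
(* y uniform on {-1,+1} *)
Definition Rnat (w : 'rV[R]_d) (b : R) : \bar R :=
  ((2^-1)%:E * Rnat_pos w b + (2^-1)%:E * Rnat_neg w b)%E.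
Definition Rrob (w : 'rV[R]_d) (b : R) : \bar R :=
  ((2^-1)%:E * Rrob_pos w b + (2^-1)%:E * Rrob_neg w b)%E.

Definition is_minimizer (F : 'rV[R]_d -> R -> \bar R) (w : 'rV[R]_d) (b : R) :=
  norm2 w = 1 /\ forall w' b', norm2 w' = 1 -> (F w b <= F w' b')%E.
End model.

Definition Phi {R : realType} (z : R) : \bar R := normal_prob 0 1 `]-oo, z[.

Definition crit {R : realType} (d : nat) (sigma c : R) : R :=
  let A := 2 * Num.sqrt (d%:R) * sigma / (sigma ^+ 2 - 1) in
  - A * c + Num.sqrt ((A / sigma) ^+ 2 * c ^+ 2 + 2 * ln sigma / (sigma ^+ 2 - 1)).

Arguments xplus {R dT T} P {d} Z eta sigma om.
Arguments xminus {R dT T} P {d} Z eta alpha om.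
Arguments Rnat_pos {R dT T} P {d} Z eta sigma w b.
Arguments Rnat_neg {R dT T} P {d} Z eta alpha w b.
Arguments Rrob_pos {R dT T} P {d} Z eta sigma eps w b.
Arguments Rrob_neg {R dT T} P {d} Z eta alpha eps w b.
Arguments Rnat {R dT T} P {d} Z eta sigma alpha w b.
Arguments Rrob {R dT T} P {d} Z eta sigma alpha eps w b.

(* Main.v *)
(* For a unit vector w the projection of a standard Gaussian vector on w is a
   standard Gaussian, so every error is a value of the normal cdf. An l_inf
   adversary of radius eps moves w . x by at most eps |w|_1, and this is
   attained, so the robust errors are the natural ones with both class margins
   diminished by eps |w|_1; the natural errors are the case eps = 0. With
   u = (positive margin + b) / sigma and D the sum of the two margins, the
   total error is (1 + Phi(- u) - Phi(D - sigma u)) / 2. It decreases in D, and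
   D is largest for the constant direction w; for fixed D the unique minimum
   over u is at the smaller root u* of (D - sigma u)^2 = u^2 + 2 ln sigma.
   Hence every minimizer has u = u*, and u* increases with D. *)
Require Import Defs.
From HB Require Import structures.
From mathcomp Require Import all_boot all_order all_algebra.
From mathcomp Require Import all_classical all_reals all_analysis.
From mathcomp Require Import measurable_realfun ring lra.
Import Order.TTheory GRing.Theory Num.Theory.
Local Open Scope classical_set_scope.
Local Open Scope ring_scope.
Import numFieldNormedType.Exports.

(** * Affine changes of variable *)

Lemma measurable_affine (R : realType) (b c : R) :
  measurable_fun [set: R] (fun y : R => b * y + c).
Proof. by apply: measurable_funD => //; exact: measurable_funM. Qed.

(* The measure instance on [pushforward m f] takes a measurability proof that
   inference does not find for a bare function. *)
Definition image_measure d1 d2 (T1 : measurableType d1) (T2 : measurableType d2)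
    (R : realType) (m : {measure set T1 -> \bar R}) (f : T1 -> T2)
    (mf : measurable_fun setT f) : {measure set T2 -> \bar R} :=
  measure_function_pushforward__canonical__measure_function_Measure m mf.
Arguments image_measure {d1 d2 T1 T2 R} m {f} mf.

(** The right-hand side is a measure in [A], so by uniqueness of Lebesgue measure it suffices to
    compare the two sides on half-open intervals. *)
Lemma lebesgue_measure_affine (R : realType) (b c : R) (A : set R) :
  b != 0 -> measurable A ->
  (lebesgue_measure A =
   `|b|%:E * lebesgue_measure ((fun y : R => b * y + c)%R @^-1` A))%E.
Proof.
move=> b0 mA.
have mf := @measurable_affine R b c.
pose f : measurableTypeR R -> measurableTypeR R := fun y => b * y + c.
have mf' : measurable_fun setT f by exact: mf.
pose k : {nonneg R} := NngNum (normr_ge0 b).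
have := @lebesgue_measure_unique R
  (mscale k (image_measure lebesgue_measure mf')).
apply => // _ [[x y] _ <-].
change (lebesgue_measure `]x, y]%classic =
  `|b|%:E * lebesgue_measure (f @^-1` `]x, y]))%E.
have [xy|yx] := ltP x y; last first.
  by rewrite set_itv_ge ?bnd_simp -?leNgt// preimage_set0 !measure0 mule0.
have [b_gt0|b_lt0] := ltP 0 b.
  have -> : f @^-1` `]x, y] = `](x - c) / b, (y - c) / b]%classic.
    apply/seteqP; split=> t; rewrite /f /= !in_itv/= ltr_pdivrMr// ler_pdivlMr//;
      by rewrite ltrBlDr lerBrDr (mulrC t).
  rewrite !lebesgue_measure_itv/= !lte_fin xy ltr_pM2r ?invr_gt0//.
  rewrite ltrD2r xy gtr0_norm// -!EFinB -EFinM; congr (_%:E).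
  by rewrite -mulrBl mulrC divfK//; ring.
(* A negative slope reverses the interval, so the closed end of the preimage is now the left one. *)
have {}b_lt0 : b < 0 by rewrite lt_neqAle b0.
have -> : f @^-1` `]x, y] = `[(y - c) / b, (x - c) / b[%classic.
  apply/seteqP; split=> t; rewrite /f /= !in_itv/= ltr_ndivlMr// ler_ndivrMr//;
    by rewrite ltrBlDr lerBrDr (mulrC t) andbC.
rewrite !lebesgue_measure_itv/= !lte_fin xy ltr_nM2r ?invr_lt0//.
rewrite ltrD2r xy ltr0_norm// -!EFinB -EFinM; congr (_%:E).
by rewrite -mulrBl mulNr mulrC divfK//; ring.
Qed.

Lemma ge0_integral_affine (R : realType) (b c : R) (f : R -> \bar R) :
  b != 0 -> measurable_fun setT f -> (forall x, 0 <= f x)%E ->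
  (\int[lebesgue_measure]_x f x =
   `|b|%:E * \int[lebesgue_measure]_x f (b * x + c)%R)%E.
Proof.
move=> b0 mf f0.
pose g : measurableTypeR R -> measurableTypeR R := fun y => b * y + c.
have mg : measurable_fun setT g by exact: measurable_affine.
pose k : {nonneg R} := NngNum (normr_ge0 b).
transitivity (\int[mscale k (image_measure lebesgue_measure mg)]_x f x)%E.
  apply: eq_measure_integral => A mA _.
  exact: (@lebesgue_measure_affine R b c A b0 mA).
rewrite ge0_integral_mscale//; congr (_ * _)%E.
exact: (ge0_integral_pushforward mg lebesgue_measure measurableT).
Qed.

(** * Linear combinations of two independent Gaussians *)

Section standard_normal.
Context {R : realType}.
Local Notation mu := (@lebesgue_measure R).
Local Notation N := (normal_prob (0 : R) 1).
Local Notation pdf := (normal_pdf (0 : R) 1).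

Lemma normal_probE (m s : R) (A : set R) : measurable A ->
  (normal_prob m s A = \int[mu]_x ((normal_pdf m s x)%:E * (\1_A x)%:E))%E.
Proof.
move=> mA; rewrite /normal_prob integral_mkcond.
apply: eq_integral => x _; rewrite patchE indicE.
by case: ifP => _; rewrite ?mule1// mule0.
Qed.

(** The explicit density and the Radon-Nikodym derivative have the same integral over every
    measurable set, hence agree almost everywhere. *)
Lemma ge0_integral_normal (m s : R) (f : R -> \bar R) :
  measurable_fun setT f -> (forall x, 0 <= f x)%E ->
  (\int[normal_prob m s]_x f x = \int[mu]_x ((normal_pdf m s x)%:E * f x))%E.
Proof.
move=> mf f0.
have mpdf : measurable_fun setT (fun x => (normal_pdf m s x)%:E).
  by apply/measurable_EFinP; exact: measurable_normal_pdf.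
have ac : normal_prob m s `<< mu by exact: normal_prob_dominates.
have mrn := measurable_int mu
  (Radon_Nikodym_SigmaFinite.f_integrable ac).
rewrite -(Radon_Nikodym_SigmaFinite.change_of_variables ac)//.
apply: ae_eq_integral => //; [exact: emeasurable_funM..|].
under [X in ae_eq _ _ _ X]eq_fun do rewrite muleC.
apply: ae_eqe_mul2l; apply: integral_ae_eq => //.
  exact: Radon_Nikodym_SigmaFinite.f_integrable.
by move=> A _ mA; rewrite -Radon_Nikodym_SigmaFinite.f_integral.
Qed.

(* The density of (x, t), where t = a x + b y, factors as that of t times the
   conditional density of x given t. *)
Lemma normal_pdf_rot (a b x t : R) : a ^+ 2 + b ^+ 2 = 1 -> b != 0 ->
  pdf x * pdf ((t - a * x) / b) = `|b| * (pdf t * normal_pdf (a * t) `|b| x).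
Proof.
move=> ab b0.
(* With [t = a x + b y], the quotient [(x - a t) / b] equals [b x - a y]: this is the invariance of
   the Euclidean norm under a rotation. *)
have E : x ^+ 2 + ((t - a * x) / b) ^+ 2 = t ^+ 2 + ((x - a * t) / b) ^+ 2.
  have b2 : b ^+ 2 = 1 - a ^+ 2 by rewrite -ab addrAC subrr add0r.
  apply: (@mulfI _ (b ^+ 2)); first by rewrite sqrf_eq0.
  transitivity (x ^+ 2 * b ^+ 2 + (t - a * x) ^+ 2); first by field.
  transitivity (t ^+ 2 * b ^+ 2 + (x - a * t) ^+ 2); last by field.
  by rewrite b2; ring.
rewrite !normal_pdfE ?oner_eq0 ?normr_eq0//.
rewrite /normal_fun /normal_peak !subr0 !expr1n !mul1r real_normK ?num_real//.
rewrite -mulrnAr sqrtrM ?sqr_ge0// sqrtr_sqr invfM.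
set c := (Num.sqrt (pi *+ 2))^-1.
transitivity (c * c * expR (- (x ^+ 2 + ((t - a * x) / b) ^+ 2) / 2)).
  rewrite mulrACA -expRD; congr (_ * expR _); lra.
transitivity (c * c * expR (- (t ^+ 2 + ((x - a * t) / b) ^+ 2) / 2)).
  by rewrite E.
have -> (u v : R) : `|b| * (c * u * (`|b|^-1 * c * v)) = c * c * (u * v).
  by field; rewrite normr_eq0.
by rewrite -expRD; congr (_ * expR _); field.
Qed.

Lemma measurable_lin2 (a b : R) (A : set R) : measurable A ->
  measurable [set p : R * R | A (a * p.1 + b * p.2)].
Proof.
move=> mA; rewrite -[X in measurable X]setTI.
have m : measurable_fun setT (fun p : R * R => a * p.1 + b * p.2).
  by apply: measurable_funD; apply: measurable_funM.
exact: m.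
Qed.

(** Substitute [t = a x + b y] for [y] in the inner integral, exchange the integrals by Tonelli, and
    integrate out [x], whose conditional density given [t] has mass one. *)
Lemma normal_prob_rot (a b : R) (A : set R) :
  a ^+ 2 + b ^+ 2 = 1 -> b != 0 -> measurable A ->
  ((N \x N) [set p | A (a * p.1 + b * p.2)%R] = N A)%E.
Proof.
move=> ab b0 mA.
have mE := measurable_lin2 a b _ mA.
set E := [set p | _] in mE *.
have mpdf m s : measurable_fun setT (normal_pdf m s : R -> R).
  exact: measurable_normal_pdf.
have b1 : `|b| != 0 by rewrite normr_eq0.
(* The joint density of [(x, t)] cut to [t] in [A]; [1 / |b|] is the Jacobian of the
   substitution. *)
pose h (p : R * R) : \bar R :=
  (pdf p.1 * (`|b|^-1 * pdf ((p.2 - a * p.1) / b) * \1_A p.2))%:E.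
have h0 p : (0 <= h p)%E.
  by rewrite lee_fin !mulr_ge0 ?normal_pdf_ge0 ?invr_ge0.
have mh : measurable_fun setT h.
  apply/measurable_EFinP; apply: measurable_funM.
    by apply: measurableT_comp.
  apply: measurable_funM; last by apply: measurableT_comp.
  apply: measurable_funM => //; apply: measurableT_comp => //.
  apply: measurable_funM => //; apply: measurable_funB => //.
  exact: measurable_funM.
have hE x : ((pdf x)%:E * N (xsection E x) = \int[mu]_t h (x, t))%E.
  have mB : measurable (xsection E x) by exact: measurable_xsection.
  pose F (y : R) : \bar R := (pdf y * \1_(xsection E x) y)%:E.
  have mF : measurable_fun setT F.
    by apply/measurable_EFinP; apply: measurable_funM.
  have F0 y : (0 <= F y)%E by rewrite lee_fin mulr_ge0 ?normal_pdf_ge0.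
  have -> : N (xsection E x) = (\int[mu]_y F y)%E.
    by rewrite normal_probE//; apply: eq_integral => y _; rewrite -EFinM.
  pose g (t : R) := b^-1 * t + - (a * x) / b.
  have mFg : measurable_fun setT (fun t => F (g t)).
    by apply: (measurableT_comp mF); exact: measurable_affine.
  rewrite (@ge0_integral_affine R b^-1 (- (a * x) / b) F) ?invr_eq0//.
  rewrite -ge0_integralZl// -ge0_integralZl//; last 3 first.
  - exact: measurable_funeM.
  - by move=> t _; rewrite mule_ge0.
  - by rewrite lee_fin normal_pdf_ge0.
  apply: eq_integral => t _; rewrite /h /F -!EFinM normfV
    [(x, t).1]/= [(x, t).2]/=.
  have tE : a * x + b * g t = t by rewrite /g; field.
  congr (_%:E); rewrite !mulrA; congr (pdf x * _ * pdf _ * _).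
    by rewrite /g /=; field.
  rewrite !indicE mem_xsection; congr ((nat_of_bool _)%:R).
  by apply/idP/idP; rewrite !inE /E /= tE.
rewrite /product_measure1 /= ge0_integral_normal//; last first.
  exact: measurable_fun_xsection.
under eq_integral do rewrite hE.
rewrite fubini_tonelli//.
rewrite normal_probE//; apply: eq_integral => t _.
have npdf_ge0 m s x : (0 <= (normal_pdf m s x : R)%:E)%E.
  by rewrite lee_fin normal_pdf_ge0.
transitivity (\int[mu]_x ((pdf t * \1_A t)%:E *
    (normal_pdf (a * t) `|b| x)%:E))%E.
  apply: eq_integral => x _; rewrite /h/= -EFinM; congr (_%:E).
  transitivity (`|b|^-1 * (pdf x * pdf ((t - a * x) / b)) * \1_A t); first ring.
  by rewrite normal_pdf_rot// mulKf// mulrAC.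
rewrite ge0_integralZl//.
- by rewrite integral_normal_pdf mule1 EFinM.
- by apply/measurable_EFinP; exact: mpdf.
- by rewrite lee_fin mulr_ge0 ?normal_pdf_ge0.
Qed.

(** Dividing both coefficients by [s] reduces this to the rotation; [w = 0] is treated apart, since
    the substitution there divides by [w / s]. *)
Lemma normal_prob_lin2 (r w s : R) (A : set R) : 0 <= r -> 0 <= s ->
  s ^+ 2 = r ^+ 2 + w ^+ 2 -> measurable A ->
  ((N \x N) [set p | A (r * p.1 + w * p.2)%R] = N [set x | A (s * x)%R])%E.
Proof.
move=> r0 s0 srw mA.
have mZ k : measurable [set x | A (k * x)].
  rewrite -[X in measurable X]setTI.
  have mk : measurable_fun setT (fun x : R => k * x) by exact: measurable_funM.
  exact: mk.
have [w0|w0] := eqVneq w 0.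
  have <- : r = s by apply/eqP; rewrite -(@eqrXn2 _ 2)// srw w0 expr0n addr0.
  have -> : [set p | A (r * p.1 + w * p.2)] = [set x | A (r * x)] `*` [set: R].
    by apply/seteqP; split=> p /=; rewrite w0 mul0r addr0 => // -[].
  rewrite product_measure1E//; last exact: mZ.
  rewrite [X in (_ * X)%E](_ : _ = 1%E) ?mule1//.
  exact: (@probability_setT _ _ _ N).
have s_neq0 : s != 0.
  apply: (contraNneq _ w0) => s00; move/eqP: srw.
  by rewrite s00 expr0n/= eq_sym paddr_eq0 ?sqr_ge0// !sqrf_eq0 => /andP[_].
have ab : (r / s) ^+ 2 + (w / s) ^+ 2 = 1.
  by rewrite !expr_div_n -mulrDl -srw divff// sqrf_eq0.
have b0 : w / s != 0 by rewrite mulf_neq0// invr_eq0.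
rewrite -(normal_prob_rot _ _ _ ab b0 (mZ s)).
congr ((N \x N) _)%E; apply/funext => p /=; congr A.
by field.
Qed.
End standard_normal.

(** * Linear forms of a Gaussian vector *)

Section linear_form.
Context {R : realType} {dT : measure_display} {T : measurableType dT}
  (P : probability T R).
Local Notation N := (normal_prob (0 : R) 1).

(* The joint law with the remaining coordinates is kept along, because only the
   product rule for the [Z i] is available: it makes the partial sum and the
   next coordinate independent at each step. *)
Lemma gaussian_partial_sum (d : nat) (Z : 'I_d -> {RV P >-> R}) (w : 'I_d -> R)
    (k : nat) (A : set R) (B : 'I_d -> set R) :
  std_gaussian_vector Z -> (k <= d)%N -> measurable A ->
  (forall i, measurable (B i)) ->
  P [set om | A (\sum_(i < d | (i < k)%N) w i * Z i om) /\
              forall i : 'I_d, (k <= i)%N -> B i (Z i om)] =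
  (N [set x | A (Num.sqrt (\sum_(i < d | (i < k)%N) w i ^+ 2) * x)%R] *
   \prod_(i < d | (k <= i)%N) N (B i))%E.
Proof.
move=> [hN hZ] + + mB; elim: k A B mB => [|k IH] A B mB kd mA.
  rewrite [X in Num.sqrt X]big1 // sqrtr0.
  have -> : (\prod_(i < d | (0 <= i)%N) N (B i) =
      P [set om | forall i, B i (Z i om)])%E.
    by rewrite hZ//; apply: eq_big => // i _; rewrite hN.
  (* The empty partial sum is the constant 0, so the first factor is 1 or 0 according to whether [A]
     contains 0. *)
  have [A0|A0] := pselect (A 0).
    rewrite (_ : [set x | A (0 * x)] = setT); last first.
      by apply/seteqP; split=> // x _; rewrite /= mul0r.
    rewrite probability_setT mul1e; congr (P _).
    apply/seteqP; split=> om /=; first by move=> [_ h] i; exact: h.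
    by move=> ?; split=> //; rewrite big1.
  rewrite (_ : [set x | A (0 * x)] = set0); last first.
    by apply/seteqP; split=> // x /=; rewrite mul0r.
  rewrite measure0 mul0e (_ : [set om | _] = set0) ?measure0//.
  by apply/seteqP; split=> // om [/=]; rewrite big1.
pose i0 := Ordinal kd.
have ltk (i : 'I_d) : ((i < k.+1) && (i != i0) = (i < k))%N.
  by rewrite ltnS [RHS]ltn_neqAle andbC -(inj_eq val_inj).
have gek (i : 'I_d) : ((k <= i) && (i != i0) = (k.+1 <= i))%N.
  by rewrite [RHS]ltn_neqAle andbC eq_sym -(inj_eq val_inj).
pose S om := \sum_(i < d | (i < k)%N) w i * Z i om.
pose r := Num.sqrt (\sum_(i < d | (i < k)%N) w i ^+ 2).
pose C := [set om | forall i : 'I_d, (k.+1 <= i)%N -> B i (Z i om)].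
have mZ i : measurable_fun setT (Z i) by exact: measurable_funPT.
have mS : measurable_fun setT S.
  rewrite /S; under eq_fun do rewrite big_mkcond/=.
  apply: measurable_sum => i; case: (i < k)%N => //.
  exact: measurable_funM.
have mC : measurable C.
  rewrite (_ : C =
      \bigcap_(i in [set i : 'I_d | (k.+1 <= i)%N]) (Z i @^-1` B i)).
    apply: fin_bigcap_measurable => // i _.
    by rewrite -[X in measurable X]setTI; exact: mZ.
  by apply/seteqP; split.
pose c : {nonneg R} := NngNum (@prodr_ge0 R _ (index_enum 'I_d)
  (fun i : 'I_d => (k.+1 <= i)%N)
  (fun i => fine (N (B i))) (fun i _ => fine_ge0 (measure_ge0 N (B i)))).
have cE : (\prod_(i < d | (k.+1 <= i)%N) N (B i) = c%:num%:E)%E.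
  transitivity (\prod_(i < d | (k.+1 <= i)%N) (fine (N (B i)))%:E)%E.
    apply: eq_bigr => i _; rewrite fineK//.
    by apply: fin_num_measure; exact: mB.
  exact: prodEFin.
pose SZ om : measurableTypeR R * measurableTypeR R := (S om, Z i0 om).
have mSZ : measurable_fun setT SZ.
  by apply: measurable_fun_pair; [exact: mS|exact: mZ].
pose rf : measurableTypeR R -> measurableTypeR R := fun x => r * x.
have mr : measurable_fun setT rf.
  exact: measurable_funM.
pose rM := isMeasurableFun.Build _ _ _ _ _ mr.
pose rx : {mfun _ >-> _} := HB.pack rf rM.
(* [m'] is the joint law of [S] and [Z i0] on the event [C], and [m''] is the law of [(r x, y)] for
   independent standard normals, scaled by [c]. Both take the value [m1 A1 * m2 A2] on
   rectangles. *)
pose m1 := distribution N rx.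
pose m2 := mscale c N.
pose m' := image_measure (mrestr P mC) mSZ.
have mrp : measurable_fun setT
    (fun p : measurableTypeR R * measurableTypeR R => (rf p.1, p.2)).
  by apply: measurable_fun_pair => //; exact: measurableT_comp.
pose m'' := mscale c (image_measure (N \x N)%E mrp).
have m'E A1 A2 : measurable A1 -> measurable A2 ->
    (m' (A1 `*` A2) = m1 A1 * m2 A2)%E.
  move=> mA1 mA2.
  (* Imposing [A2] on coordinate [i0] turns the rectangle into an event covered by the induction
     hypothesis. *)
  pose B' i := if i == i0 then A2 else B i.
  have mB' i : measurable (B' i : set R).
    by rewrite /B'; case: ifP => _; [exact: mA2|exact: mB].
  transitivity (P [set om | A1 (S om) /\
      forall i : 'I_d, (k <= i)%N -> B' i (Z i om)]).
    congr (P _); apply/seteqP; split=> om.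
      move=> [[A1S A2Z] CZ]; split=> // i ki; rewrite /B';
        case: eqVneq => [->//|ii0].
      by apply: CZ; rewrite -gek ki.
    move=> [A1S B'Z]; split=> /=.
      by split=> //; have := B'Z i0 (leqnn k); rewrite /B' eqxx.
    move=> i; rewrite -gek => /andP[/B'Z + /negPf ii0].
    by rewrite /B' ii0.
  rewrite IH//; last exact: ltnW.
  have -> : (\prod_(i < d | (k <= i)%N) N (B' i) = N A2 * c%:num%:E)%E.
    rewrite (bigD1 i0)//=; congr (_ * _)%E; first by rewrite /B' eqxx.
    rewrite -cE; apply: eq_big => i; first exact: gek.
    by move=> /andP[_ /negPf ii0]; rewrite /B' ii0.
  by rewrite (muleC (N A2)).
have m''E A1 A2 : measurable A1 -> measurable A2 ->
    (m'' (A1 `*` A2) = m1 A1 * m2 A2)%E.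
  move=> mA1 mA2.
  change (c%:num%:E * (N \x N) ((rf @^-1` A1) `*` A2) =
    N (rf @^-1` A1) * (c%:num%:E * N A2))%E.
  rewrite product_measure1E//; first by rewrite muleCA.
  by rewrite -[X in measurable X]setTI; apply: (mr measurableT).
pose E :=
  [set p : measurableTypeR R * measurableTypeR R | A (p.1 + w i0 * p.2)].
have mE : measurable E.
  have mp : measurable_fun setT
      (fun p : measurableTypeR R * measurableTypeR R =>
        (p.1 + w i0 * p.2 : measurableTypeR R)).
    by apply: measurable_funD => //; apply: measurable_funM.
  by rewrite -[X in measurable X]setTI; apply: mp.
(* Agreement on rectangles extends to [E], the event that the enlarged partial sum lies in [A],
   which is not itself a rectangle. *)
have EE := product_measure_unique m'E mE.
rewrite (product_measure_unique m''E mE) in EE.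
transitivity (m' E).
  have SE om : \sum_(i < d | (i < k.+1)%N) w i * Z i om = S om + w i0 * Z i0 om.
    by rewrite (bigD1 i0)//= addrC; congr (_ + _); apply: eq_bigl.
  by congr (P _); apply/funext => om /=; rewrite SE.
rewrite -EE {EE} cE.
transitivity (c%:num%:E *
    (N \x N) [set p | A (r * p.1 + w i0 * p.2)%R])%E => //.
rewrite (@normal_prob_lin2 _ r (w i0)
  (Num.sqrt (\sum_(i < d | (i < k.+1)%N) w i ^+ 2))) ?sqrtr_ge0//.
  by rewrite muleC.
rewrite !sqr_sqrtr ?sumr_ge0//; last 2 first.
- by move=> i _; rewrite sqr_ge0.
- by move=> i _; rewrite sqr_ge0.
by rewrite (bigD1 i0)//= addrC; congr (_ + _); apply: eq_bigl.
Qed.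

Lemma gaussian_linear_form (d : nat) (Z : 'I_d -> {RV P >-> R}) (w : 'I_d -> R)
    (A : set R) :
  std_gaussian_vector Z -> \sum_i w i ^+ 2 = 1 -> measurable A ->
  P [set om | A (\sum_i w i * Z i om)] = N A.
Proof.
move=> hZ w1 mA.
have := @gaussian_partial_sum d Z w d A (fun=> setT) hZ (leqnn d) mA
  (fun=> measurableT).
have lt_d (i : 'I_d) : (i < d)%N = true by exact: ltn_ord.
have ge_d (i : 'I_d) : (d <= i)%N = false by rewrite leqNgt lt_d.
rewrite [X in (_ * X)%E]big1 ?mule1; last by move=> i; rewrite ge_d.
rewrite (eq_bigl xpredT)// w1 sqrtr1.
have -> : [set x | A (1 * x)] = A by apply/funext => x /=; rewrite mul1r.
move=> <-; congr (P _); apply/funext => om /=; apply/propext.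
split=> [AZ|[AZ _]].
  by split=> //; rewrite (eq_bigl xpredT).
by rewrite (eq_bigl xpredT) in AZ.
Qed.
End linear_form.

(** * The one-dimensional optimization problem *)

Section cdf.
Context {R : realType}.
Local Notation N := (normal_prob (0 : R) 1).
Local Notation pdf := (normal_pdf (0 : R) 1).
Local Notation phi z := (fine (Phi (z : R))).

Lemma PhiE (z : R) : Phi z = (phi z)%:E.
Proof. by rewrite fineK// /Phi; apply: fin_num_measure. Qed.

Lemma normal_prob_ge (z : R) : N [set x | z <= x] = (1 - phi z)%:E.
Proof.
have -> : [set x | z <= x] = ~` `]-oo, z[.
  by apply/seteqP; split=> x /=; rewrite in_itv/= leNgt => /negP.
rewrite probability_setC//; transitivity (1 - Phi z)%E => //.
by rewrite {1}PhiE EFinB.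
Qed.

Lemma is_derive_phi (x : R) : is_derive x 1 (fun z => phi z) (pdf x).
Proof.
have -> : (fun z => phi z) =
    (fun y => \int[lebesgue_measure]_(t in [set` `]-oo, y]]) (pdf t))%R.
  apply/funext => y; rewrite /Rintegral /Phi /normal_prob; congr fine.
  (* [Phi] uses the open half-line and the fundamental theorem the closed one; the endpoint is a
     null set. *)
  rewrite integral_itv_bndo_bndc//.
  by apply/measurable_EFinP/measurable_funTS; exact: measurable_normal_pdf.
have [] := @continuous_FTC1 R pdf (BInfty _ true) x (x + 1).
- by rewrite ltrDl.
- by apply: integrableS (integrable_normal_pdf 0 1).
- by rewrite ltNyr.
- by apply: continuous_normal_pdf; rewrite oner_eq0.
by move=> dF F'E; split; [exact: dF|rewrite -derive1E; exact: F'E].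
Qed.

Lemma pdf_gt0 (x : R) : 0 < pdf x.
Proof.
rewrite normal_pdfE ?oner_eq0// mulr_gt0 ?expR_gt0//.
by rewrite normal_peak_gt0 ?oner_eq0.
Qed.

Lemma phi_lt (x y : R) : x < y -> phi x < phi y.
Proof.
move=> xy.
have d z : derivable (fun z => phi z) z 1 by have [] := is_derive_phi z.
apply: (@gtr0_derive1_lt_cc _ (fun z => phi z) x y) => //.
- by move=> z _; rewrite derive1E
    (@derive_val _ _ _ _ _ _ _ (is_derive_phi z)) pdf_gt0.
- apply: continuous_subspaceT => z.
  exact/differentiable_continuous/derivable1_diffP.
- by rewrite in_itv/= lexx ltW.
- by rewrite in_itv/= lexx ltW.
Qed.

Lemma phi_lt_mono : {mono (fun z => phi z) : x y / x < y}.
Proof.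
by apply: leW_mono; apply: le_mono; exact: phi_lt.
Qed.

(* Up to an affine change, [psi D s] is the total error as a function of the
   threshold: if the positive error is [Phi (- u)], the negative one is
   [1 - Phi (D - s u)], where [D] is the sum of the two class margins. *)
Definition psi (D s u : R) : R := phi (- u) - phi (D - s * u).

Lemma is_derive_psi (D s u : R) :
  is_derive u 1 (psi D s) (s * pdf (D - s * u) - pdf (- u)).
Proof.
have h1 : is_derive u 1 (fun u : R => - u) (- 1) by exact: is_deriveN.
have h2 : is_derive u 1 (fun u : R => D - s * u) (- s).
  apply: is_derive_eq; by rewrite add0r mul1r -[s%:A]/(s * 1) mulr1.
have h3 := @is_derive1_comp _ (fun z => phi z) _ _ _ _ (is_derive_phi (- u)) h1.
have h4 := @is_derive1_comp _ (fun z => phi z) (fun u => D - s * u) _ _ _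
  (is_derive_phi (D - s * u)) h2.
rewrite (_ : _ - _ = pdf (- u) * -1 - pdf (D - s * u) * - s); last by ring.
exact: is_deriveB.
Qed.

(** Taking logarithms turns the sign of the derivative of [psi] into the sign of a quadratic
    polynomial. *)
Lemma scaled_pdf_lt (s t x y : R) : 0 < s -> 0 < t ->
  (s * pdf x < t * pdf y) = (2 * ln s - x ^+ 2 < 2 * ln t - y ^+ 2).
Proof.
move=> s0 t0; rewrite !normal_pdfE ?oner_eq0// /normal_fun !subr0 expr1n.
rewrite !(mulrCA _ (normal_peak _)) ltr_pM2l ?normal_peak_gt0 ?oner_eq0//.
rewrite -{1}(lnK s0) -{1}(lnK t0) -!expRD ltr_expR.
by apply/idP/idP => ?; lra.
Qed.

(* The stationary points of [psi D s] are the roots of the quadratic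
   [(D - s u)^2 = u^2 + 2 ln s]; [ustar] is the smaller one. *)
Definition ustar (D s : R) : R :=
  (s * D - Num.sqrt (D ^+ 2 + 2 * (s ^+ 2 - 1) * ln s)) / (s ^+ 2 - 1).

Section optimum.
Variables (D s : R).
Hypotheses (s1 : 1 < s) (D0 : 0 < D).
Let q := Num.sqrt (D ^+ 2 + 2 * (s ^+ 2 - 1) * ln s).
Let um := (s * D - q) / (s ^+ 2 - 1).
Let up := (s * D + q) / (s ^+ 2 - 1).

Let s21 : 0 < s ^+ 2 - 1. Proof. by have := s1; nra. Qed.
Let ln_s : 0 < ln s. Proof. exact: ln_gt0. Qed.
Let q2 : q ^+ 2 = D ^+ 2 + 2 * (s ^+ 2 - 1) * ln s.
Proof. by rewrite sqr_sqrtr// addr_ge0 ?sqr_ge0// !mulr_ge0 ?ltW. Qed.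
Let qD : D < q.
Proof.
rewrite -(@ltr_pXn2r _ 2) ?nnegrE ?sqrtr_ge0 ?(ltW D0)// q2 ltrDl.
by rewrite !mulr_gt0.
Qed.

(** The leading coefficient is [s ^+ 2 - 1] and [q ^+ 2] is the reduced discriminant, so [um] and
    [up] are the roots. *)
Let quadE u : (D - s * u) ^+ 2 - (u ^+ 2 + 2 * ln s) =
  (s ^+ 2 - 1) * (u - um) * (u - up).
Proof.
apply: (@mulfI _ (s ^+ 2 - 1)); first by rewrite gt_eqF.
rewrite /um /up.
transitivity (((s ^+ 2 - 1) * u - s * D) ^+ 2 - q ^+ 2).
  by rewrite q2; ring.
by field; rewrite gt_eqF.
Qed.

(** Clearing denominators, this bound and the next one amount to [- D < q] and [D < q]. *)
Let um_lt : um < D / (s - 1).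
Proof.
rewrite /um ltr_pdivrMr// mulrAC ltr_pdivlMr ?subr_gt0//.
have := qD; have := s1; have := D0; nra.
Qed.

Let up_gt : D / (s - 1) < up.
Proof.
rewrite /up ltr_pdivlMr// mulrAC ltr_pdivrMr ?subr_gt0//.
have := qD; have := s1; have := D0; nra.
Qed.

(** [psi] decreases up to [um] and increases from there to [up]. Past [up] it decreases again
    towards 0, so monotonicity alone is not enough there and the sign of [psi] is used instead. *)
Lemma psi_min u : u != ustar D s -> psi D s (ustar D s) < psi D s u.
Proof.
rewrite -[ustar D s]/um.
have s0 : 0 < s by rewrite (lt_trans _ s1).
have dpsi x : derivable (psi D s) x 1 by have [] := is_derive_psi D s x.
have dpsiE x : derive1 (psi D s) x = s * pdf (D - s * x) - pdf (- x).
  by rewrite derive1E (@derive_val _ _ _ _ _ _ _ (is_derive_psi D s x)).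
have cpsi a b : {within `[a, b], continuous (psi D s)}.
  apply: continuous_subspaceT => z.
  exact/differentiable_continuous/derivable1_diffP.
rewrite neq_lt => /orP[uum|umu].
  apply: (@ltr0_derive1_lt_cc _ (psi D s) u um) => //.
  - move=> x; rewrite in_itv/= => /andP[_ xum].
    (* The factor 1 is inserted so that both sides are scaled densities; its logarithm vanishes. *)
    rewrite dpsiE subr_lt0 -[ltRHS]mul1r scaled_pdf_lt// ln1 sqrrN.
    suff : 0 < (D - s * x) ^+ 2 - (x ^+ 2 + 2 * ln s) by lra.
    rewrite quadE.
    have : um < up by rewrite (lt_trans um_lt).
    rewrite nmulr_rgt0 ?subr_lt0; last by rewrite pmulr_rlt0 ?subr_lt0.
    exact: lt_trans xum.
  - by rewrite in_itv/= lexx ltW.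
  - by rewrite in_itv/= lexx ltW.
(* [D / (s - 1)] is the zero of [psi D s] and lies strictly between the two
   stationary points, so beyond it [psi >= 0 > psi ustar]. *)
have [uD|Du] := ltP u (D / (s - 1)); last first.
  apply: (@lt_le_trans _ _ 0).
    rewrite subr_lt0 phi_lt//; have := um_lt.
    rewrite ltr_pdivlMr ?subr_gt0//; lra.
  rewrite subr_ge0 leNgt phi_lt_mono -leNgt; move: Du.
  rewrite ler_pdivrMr ?subr_gt0//; lra.
apply: (@gtr0_derive1_lt_cc _ (psi D s) um u) => //.
- move=> x; rewrite in_itv/= => /andP[umx xu].
  rewrite dpsiE subr_gt0 -[ltLHS]mul1r scaled_pdf_lt// ln1 sqrrN.
  suff : (D - s * x) ^+ 2 - (x ^+ 2 + 2 * ln s) < 0 by lra.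
  rewrite quadE.
  have xup : x < up by rewrite (lt_trans xu)// (lt_trans uD).
  have p : 0 < (s ^+ 2 - 1) * (x - um) by rewrite mulr_gt0// subr_gt0.
  by rewrite pmulr_rlt0// subr_lt0.
- by rewrite in_itv/= lexx ltW.
- by rewrite in_itv/= lexx ltW.
Qed.
End optimum.

Lemma psi_decr (s u D1 D2 : R) : D1 <= D2 -> psi D2 s u <= psi D1 s u.
Proof.
move=> D12; rewrite lerD2l lerN2 leNgt phi_lt_mono -leNgt; lra.
Qed.

(** The square root of [D ^+ 2 + K] grows by less than [D2 - D1], whereas [s * D] grows by [s] times
    that amount and [s > 1]. *)
Lemma ustar_incr (s D1 D2 : R) : 1 < s -> 0 < D1 -> D1 < D2 ->
  ustar D1 s < ustar D2 s.
Proof.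
move=> s1 D10 D12; have s21 : 0 < s ^+ 2 - 1 by nra.
rewrite /ustar ltr_pM2r ?invr_gt0//.
have K0 : 0 < 2 * (s ^+ 2 - 1) * ln s by rewrite !mulr_gt0// ln_gt0.
set K := (2 * _ * _) in K0 *.
set q1 := Num.sqrt (D1 ^+ 2 + K); set q2 := Num.sqrt (D2 ^+ 2 + K).
have q10 : 0 <= q1 by exact: sqrtr_ge0.
have q1E : q1 ^+ 2 = D1 ^+ 2 + K by rewrite sqr_sqrtr// addr_ge0 ?sqr_ge0// ltW.
have q2E : q2 ^+ 2 = D2 ^+ 2 + K by rewrite sqr_sqrtr// addr_ge0 ?sqr_ge0// ltW.
have D1q1 : D1 < q1.
  by rewrite -(@ltr_pXn2r _ 2) ?nnegrE ?(ltW D10)// q1E ltrDl.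
suff : q2 < q1 + (D2 - D1) by nra.
rewrite -(@ltr_pXn2r _ 2) ?nnegrE ?sqrtr_ge0//; last by nra.
by rewrite q2E; nra.
Qed.

(** The radicand of [ustar] is [(s ^+ 2 - 1) ^+ 2] times that of [crit]. *)
Lemma crit_ustar (d : nat) (s c : R) : 1 < s -> 0 <= c ->
  crit d s c = - ustar (2 * Num.sqrt d%:R * c) s.
Proof.
move=> s1 c0; have s21 : 0 < s ^+ 2 - 1 by nra.
rewrite /crit /ustar; set r := Num.sqrt d%:R; set D := 2 * r * c.
have -> : D ^+ 2 + 2 * (s ^+ 2 - 1) * ln s = (s ^+ 2 - 1) ^+ 2 *
   ((2 * r * s / (s ^+ 2 - 1) / s) ^+ 2 * c ^+ 2 + 2 * ln s / (s ^+ 2 - 1)).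
  by rewrite /D; field; rewrite !gt_eqF//; lra.
rewrite sqrtrM ?sqr_ge0// sqrtr_sqr gtr0_norm//.
set Q := Num.sqrt _.
by rewrite /D; field; rewrite gt_eqF.
Qed.
End cdf.

(** * Natural and robust errors of a linear classifier *)

Section risks.
Context {R : realType} {dT : measure_display} {T : measurableType dT}
  (P : probability T R) {d : nat} (Z : 'I_d -> {RV P >-> R}).
Variables (eta sigma alpha eps : R).
Hypotheses (hZ : std_gaussian_vector Z) (s0 : 0 < sigma) (eps0 : 0 <= eps).
Local Notation phi z := (fine (Phi (z : R))).
Implicit Types (w x : 'rV[R]_d) (b : R).

Definition sumv w : R := \sum_i w ord0 i.
Definition norm1 w : R := \sum_i `|w ord0 i|.

Lemma dotvDr w x y : dotv w (x + y) = dotv w x + dotv w y.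
Proof.
by rewrite /dotv -big_split; apply: eq_bigr => i _; rewrite mxE mulrDr.
Qed.

Lemma norm_dotv_le w x : linf_le eps x -> `|dotv w x| <= eps * norm1 w.
Proof.
move=> xe; rewrite (le_trans (ler_norm_sum _ _ _))// mulr_sumr ler_sum// => i _.
by rewrite normrM mulrC ler_wpM2r.
Qed.

Lemma norm_dotv_attained w : exists2 x, linf_le eps x & dotv w x = eps * norm1 w.
Proof.
(* The extremal perturbation follows the signs of [w]; where [w] has a zero entry it is 0, at no
   loss. *)
exists (\row_i (eps * Num.sg (w ord0 i))).
  move=> i; rewrite mxE normrM ger0_norm// normr_sg ler_piMr//.
  by case: (_ != 0).
rewrite /dotv /norm1 mulr_sumr; apply: eq_bigr => i _.
by rewrite mxE mulrCA [w _ _ * _]mulrC -normrEsg.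
Qed.

Lemma linf_leN x : linf_le eps x -> linf_le eps (- x).
Proof. by move=> xe i; rewrite mxE normrN. Qed.

Lemma clf_neq1 w b x : (clf w b x != 1) = (dotv w x + b < 0).
Proof.
rewrite /clf /sgn ltNge; case: ifP => _; first by rewrite eqxx.
by rewrite lt_eqF// gtrN.
Qed.

Lemma clf_neqN1 w b x : (clf w b x != -1) = (0 <= dotv w x + b).
Proof.
rewrite /clf /sgn; case: ifP => _; last by rewrite eqxx.
by rewrite gt_eqF// gtrN.
Qed.

(** The lowest reachable score is attained, and score 0 is classified as +1; hence the inequality is
    strict here and weak in the companion statement for the label -1. *)
Lemma exists_clf_neq1 w b x :
  (exists delta, linf_le eps delta /\ clf w b (x + delta) != 1) <->
  dotv w x + b < eps * norm1 w.
Proof.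
split=> [[t [te]]|].
  rewrite clf_neq1 dotvDr; have := norm_dotv_le w _ te.
  by rewrite ler_norml => /andP[]; lra.
have [t te tE] := norm_dotv_attained w => h.
exists (- t); split; first exact: linf_leN.
rewrite clf_neq1 dotvDr.
have -> : dotv w (- t) = - dotv w t.
  by rewrite /dotv -sumrN; apply: eq_bigr => i _; rewrite mxE mulrN.
rewrite tE; lra.
Qed.

Lemma exists_clf_neqN1 w b x :
  (exists delta, linf_le eps delta /\ clf w b (x + delta) != -1) <->
  - (eps * norm1 w) <= dotv w x + b.
Proof.
split=> [[t [te]]|].
  rewrite clf_neqN1 dotvDr; have := norm_dotv_le w _ te.
  by rewrite ler_norml => /andP[]; lra.
have [t te tE] := norm_dotv_attained w => h.
by exists t; split=> //; rewrite clf_neqN1 dotvDr tE; lra.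
Qed.

Lemma dotv_xplus w om : dotv w (xplus P Z eta sigma om) =
  eta * sumv w + sigma * \sum_i w ord0 i * Z i om.
Proof.
rewrite /dotv /sumv !mulr_sumr -big_split; apply: eq_bigr => i _.
by rewrite !mxE /=; ring.
Qed.

Lemma dotv_xminus w om : dotv w (xminus P Z eta alpha om) =
  - (alpha * eta * sumv w) + \sum_i w ord0 i * Z i om.
Proof.
rewrite /dotv /sumv mulr_sumr -sumrN -big_split; apply: eq_bigr => i _.
by rewrite !mxE /=; ring.
Qed.

Lemma norm2_sum w : norm2 w = 1 -> \sum_i w ord0 i ^+ 2 = 1.
Proof.
move=> w1; rewrite -[RHS](expr1n _ 2) -w1 sqr_sqrtr//.
by apply: sumr_ge0 => i _; rewrite sqr_ge0.
Qed.

Definition upos w b : R := (eta * sumv w - eps * norm1 w + b) / sigma.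

(** Sum of the worst-case class margins [eta * sumv w - eps * norm1 w] and
    [alpha * eta * sumv w - eps * norm1 w]; it plays the part of [D] in [psi]. *)
Definition margin w : R := (1 + alpha) * eta * sumv w - 2 * eps * norm1 w.

Lemma Rrob_posE w b : norm2 w = 1 ->
  Rrob_pos P Z eta sigma eps w b = (phi (- upos w b))%:E.
Proof.
move=> /norm2_sum w1; rewrite -PhiE /Phi.
rewrite -(gaussian_linear_form P d Z _ _ hZ w1)//; congr (P _).
apply/seteqP; split=> om /=.
  move=> /exists_clf_neq1; rewrite dotv_xplus in_itv/= /upos => h.
  by rewrite -mulNr ltr_pdivlMr//; lra.
rewrite in_itv/= /upos -mulNr ltr_pdivlMr// => h.
by apply/exists_clf_neq1; rewrite dotv_xplus; lra.
Qed.

Lemma Rrob_negE w b : norm2 w = 1 ->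
  Rrob_neg P Z eta alpha eps w b = (1 - phi (margin w - sigma * upos w b))%:E.
Proof.
move=> /norm2_sum w1; rewrite -normal_prob_ge.
have m : measurable [set x | margin w - sigma * upos w b <= x].
  by rewrite -set_itvcy; exact: measurable_itv.
rewrite -(gaussian_linear_form P d Z _ _ hZ w1)//; congr (P _).
have E : margin w - sigma * upos w b = alpha * eta * sumv w - eps * norm1 w - b.
  by rewrite /margin /upos [sigma * _]mulrC divfK ?gt_eqF//; ring.
apply/seteqP; split=> om /=; rewrite E.
  by move=> /exists_clf_neqN1; rewrite dotv_xminus; lra.
by move=> h; apply/exists_clf_neqN1; rewrite dotv_xminus; lra.
Qed.

Lemma RrobE w b : norm2 w = 1 -> Rrob P Z eta sigma alpha eps w b =
  (2^-1 * (1 + psi (margin w) sigma (upos w b)))%:E.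
Proof.
move=> w1; rewrite /Rrob Rrob_posE// Rrob_negE// -!EFinM -EFinD; congr (_%:E).
by rewrite /psi; ring.
Qed.

(** Cauchy-Schwarz against the constant vector, obtained by expanding a sum of squares that vanishes
    when all [|w_i|] equal [1 / sqrt d]. *)
Lemma norm1_le w : (0 < d)%N -> norm2 w = 1 -> norm1 w <= Num.sqrt d%:R.
Proof.
move=> d0 /norm2_sum w1; set r := Num.sqrt _.
have r0 : 0 < r by rewrite sqrtr_gt0 ltr0n.
have r2 : r ^+ 2 = d%:R by rewrite sqr_sqrtr// ler0n.
have : 0 <= \sum_(i < d) (`|w ord0 i| - r^-1) ^+ 2.
  by apply: sumr_ge0 => i _; rewrite sqr_ge0.
have -> : \sum_(i < d) (`|w ord0 i| - r^-1) ^+ 2 = 2 - 2 * r^-1 * norm1 w.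
  transitivity (\sum_(i < d)
      (w ord0 i ^+ 2 - 2 * r^-1 * `|w ord0 i| + r^-1 ^+ 2)).
    apply: eq_bigr => i _; rewrite -[w _ _ ^+ 2]real_normK ?num_real//; ring.
  rewrite 2!big_split/= w1 sumrN -mulr_sumr sumr_const card_ord.
  rewrite -[_ *+ d]mulr_natr -r2 exprVn mulVf ?sqrf_eq0 ?gt_eqF//; rewrite /norm1; ring.
move=> h; have : norm1 w / r <= 1 by lra.
by rewrite ler_pdivrMr// mul1r.
Qed.

(** First [sumv w <= norm1 w], then [norm1 w <= sqrt d]; the latter is multiplied by a coefficient
    that [2 * eps <= (1 + alpha) * eta] makes nonnegative. *)
Lemma margin_le w : (0 < d)%N -> 0 <= eta -> -1 <= alpha ->
  2 * eps <= (1 + alpha) * eta -> norm2 w = 1 ->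
  margin w <= ((1 + alpha) * eta - 2 * eps) * Num.sqrt d%:R.
Proof.
move=> d0 eta0 a1 ea w1; have wd := norm1_le _ d0 w1.
have Sw : sumv w <= norm1 w by apply: ler_sum => i _; exact: ler_norm.
apply: (@le_trans _ _ (((1 + alpha) * eta - 2 * eps) * norm1 w)).
  rewrite mulrBl lerD2r ler_wpM2l// mulr_ge0//; lra.
by rewrite ler_wpM2l// subr_ge0.
Qed.

(** The unit vector along the class mean, at which the bound on the margin is attained. *)
Definition diagv : 'rV[R]_d := \row_i (Num.sqrt d%:R)^-1.

(** The root is a separate variable [r] so that replacing [d%:R] by [r ^+ 2] does not also rewrite
    inside the root. *)
Lemma diagv_sum (r : R) : (0 < d)%N -> r = Num.sqrt d%:R ->
  \sum_(i < d) r^-1 = r.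
Proof.
move=> d0 rE; rewrite sumr_const card_ord -mulr_natr.
have -> : (d%:R : R) = r ^+ 2 by rewrite rE sqr_sqrtr// ler0n.
by rewrite expr2 mulKf// rE gt_eqF// sqrtr_gt0 ltr0n.
Qed.

Lemma norm2_diagv : (0 < d)%N -> norm2 diagv = 1.
Proof.
move=> d0; rewrite /norm2 -[RHS]sqrtr1; congr Num.sqrt.
under eq_bigr do rewrite mxE expr2.
by rewrite -mulr_sumr diagv_sum// mulVf// gt_eqF// sqrtr_gt0 ltr0n.
Qed.

Lemma margin_diagv : (0 < d)%N ->
  margin diagv = ((1 + alpha) * eta - 2 * eps) * Num.sqrt d%:R.
Proof.
move=> d0; rewrite /margin.
have -> : sumv diagv = Num.sqrt d%:R.
  by rewrite /sumv; under eq_bigr do rewrite mxE; rewrite diagv_sum.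
have -> : norm1 diagv = Num.sqrt d%:R.
  rewrite /norm1; under eq_bigr do rewrite mxE ger0_norm ?invr_ge0 ?sqrtr_ge0//.
  by rewrite diagv_sum.
by ring.
Qed.
End risks.

(** * Minimizers *)

Section minimizers.
Context {R : realType} {dT : measure_display} {T : measurableType dT}
  (P : probability T R) {d : nat} (Z : 'I_d -> {RV P >-> R}).
Variables (eta sigma : R).
Hypotheses (hd : (0 < d)%N) (heta : 0 < eta) (hsigma : 1 < sigma)
  (hZ : std_gaussian_vector Z).

(** Admitting [eps = 0] covers the natural error. The positive error depends on [(w, b)] only
    through [upos], so it suffices to find [upos] at a minimizer, without identifying its
    direction. *)
Lemma Rrob_pos_minimizer (alpha eps : R) :
  1 <= alpha -> 0 <= eps -> eps < eta ->
  (exists w b, is_minimizer (Rrob P Z eta sigma alpha eps) w b) /\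
  (forall w b, is_minimizer (Rrob P Z eta sigma alpha eps) w b ->
    Rrob_pos P Z eta sigma eps w b =
    Phi (crit d sigma ((1 + alpha) / 2 * eta - eps))).
Proof.
move=> a1 eps0 epseta.
have s0 : 0 < sigma by exact: lt_trans hsigma.
have r0 : 0 < Num.sqrt (d%:R : R) by rewrite sqrtr_gt0 ltr0n.
(* This product gives [(1 + alpha) / 2 * eta >= eta > eps], whence [c > 0] by linear arithmetic. *)
have ae : 0 <= (alpha - 1) * eta by rewrite mulr_ge0 ?subr_ge0// ltW.
have c0 : 0 < (1 + alpha) / 2 * eta - eps by lra.
set c := _ - eps in c0 *.
pose D := ((1 + alpha) * eta - 2 * eps) * Num.sqrt d%:R.
have DE : D = 2 * Num.sqrt d%:R * c by rewrite /D /c; field.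
have D0 : 0 < D by rewrite DE !mulr_gt0.
have wE := RrobE P Z eta sigma alpha eps hZ s0 eps0.
have nv : norm2 (@diagv R d) = 1 by exact: norm2_diagv.
pose u := ustar D sigma.
(* The bias solving [upos = u] for the diagonal direction. *)
pose b0 := sigma * u - (eta * sumv (@diagv R d) - eps * norm1 (@diagv R d)).
have uE : upos eta sigma eps (@diagv R d) b0 = u.
  by rewrite /upos /b0 [X in X / _]addrC subrK mulrC mulKf// gt_eqF.
have mE : margin eta alpha eps (@diagv R d) = D by rewrite margin_diagv.
have le_psi (w : 'rV[R]_d) b : norm2 w = 1 ->
    psi D sigma (upos eta sigma eps w b) <=
    psi (margin eta alpha eps w) sigma (upos eta sigma eps w b).
  by move=> w1; apply: psi_decr; apply: margin_le => //; lra.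
split.
  exists (@diagv R d), b0; split=> // w b w1; rewrite !wE// lee_fin uE mE.
  rewrite ler_pM2l ?invr_gt0// lerD2l (le_trans _ (le_psi w b w1))//.
  have [->//|neq] := eqVneq (upos eta sigma eps w b) u.
  by rewrite ltW// psi_min.
move=> w b [w1 wmin].
rewrite Rrob_posE// -PhiE crit_ustar ?(ltW c0)// -DE; congr (Phi (- _)).
(* A minimizer with [upos] different from [u] would have a strictly larger error than the diagonal
   classifier with bias [b0]. *)
apply/eqP/contraT => neq; have := wmin (@diagv R d) b0 nv.
rewrite !wE// lee_fin uE mE ler_pM2l ?invr_gt0// lerD2l leNgt.
by rewrite (lt_le_trans _ (le_psi w b w1))// psi_min.
Qed.

Lemma crit_decr (c1 c2 : R) : 0 < c1 -> c1 < c2 ->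
  crit d sigma c2 < crit d sigma c1.
Proof.
move=> c10 c12; have r0 : 0 < Num.sqrt (d%:R : R) by rewrite sqrtr_gt0 ltr0n.
have c20 := lt_trans c10 c12.
rewrite !crit_ustar ?(ltW c10) ?(ltW c20)// ltrN2 ustar_incr// ?mulr_gt0//.
by rewrite ltr_pM2l ?mulr_gt0.
Qed.

Lemma Rrob_pos_minimizer_decr (alpha1 alpha2 eps : R) w1 b1 w2 b2 :
  1 <= alpha1 -> alpha1 < alpha2 -> 0 <= eps -> eps < eta ->
  is_minimizer (Rrob P Z eta sigma alpha1 eps) w1 b1 ->
  is_minimizer (Rrob P Z eta sigma alpha2 eps) w2 b2 ->
  (Rrob_pos P Z eta sigma eps w2 b2 < Rrob_pos P Z eta sigma eps w1 b1)%E.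
Proof.
move=> a1 a12 eps0 epseta h1 h2.
have a2 : 1 <= alpha2 by lra.
have e1 := (Rrob_pos_minimizer _ _ a1 eps0 epseta).2 _ _ h1.
have e2 := (Rrob_pos_minimizer _ _ a2 eps0 epseta).2 _ _ h2.
have ae1 : 0 <= (alpha1 - 1) * eta by rewrite mulr_ge0 ?subr_ge0// ltW.
have ae2 : 0 < (alpha2 - alpha1) * eta by rewrite mulr_gt0 ?subr_gt0.
by rewrite e1 e2 [in ltLHS]PhiE [in ltRHS]PhiE lte_fin phi_lt// crit_decr//; lra.
Qed.

Lemma Rrob_pos0 : Rrob_pos P Z eta sigma 0 = Rnat_pos P Z eta sigma.
Proof.
apply/funext => w; apply/funext => b; congr (P _); apply/seteqP.
split=> om /=; rewrite clf_neq1.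
  by move=> /exists_clf_neq1; rewrite mul0r; apply.
by move=> h; apply/exists_clf_neq1; rewrite ?mul0r.
Qed.

Lemma Rrob0 alpha : Rrob P Z eta sigma alpha 0 = Rnat P Z eta sigma alpha.
Proof.
apply/funext => w; apply/funext => b; rewrite /Rrob /Rnat Rrob_pos0.
congr (_ + _ * P _)%E; apply/seteqP; split=> om /=; rewrite clf_neqN1.
  by move=> /exists_clf_neqN1; rewrite mul0r oppr0; apply.
by move=> h; apply/exists_clf_neqN1; rewrite ?mul0r ?oppr0.
Qed.
End minimizers.

Theorem theorem1 (R : realType) (d : nat) (eta sigma eps : R)
  (hd : (1 <= d)%N) (heta : 0 < eta) (hsigma : 1 < sigma)
  (heps0 : 0 < eps) (hepseta : eps < eta)
  (dT : measure_display) (T : measurableType dT) (P : probability T R)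
  (Z : 'I_d -> {RV P >-> R}) (hZ : std_gaussian_vector Z) :
  (forall alpha : R, 1 <= alpha ->
     ((exists w b, is_minimizer (Rnat P Z eta sigma alpha) w b) /\
      (forall w b, is_minimizer (Rnat P Z eta sigma alpha) w b ->
         Rnat_pos P Z eta sigma w b
         = Phi (crit d sigma ((1 + alpha) / 2 * eta)))) /\
     ((exists w b, is_minimizer (Rrob P Z eta sigma alpha eps) w b) /\
      (forall w b, is_minimizer (Rrob P Z eta sigma alpha eps) w b ->
         Rrob_pos P Z eta sigma eps w b
         = Phi (crit d sigma ((1 + alpha) / 2 * eta - eps))))) /\
  (forall alpha1 alpha2 : R, 1 <= alpha1 -> alpha1 < alpha2 ->
     (forall w1 b1 w2 b2,
        is_minimizer (Rnat P Z eta sigma alpha1) w1 b1 ->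
        is_minimizer (Rnat P Z eta sigma alpha2) w2 b2 ->
        (Rnat_pos P Z eta sigma w2 b2 < Rnat_pos P Z eta sigma w1 b1)%E) /\
     (forall w1 b1 w2 b2,
        is_minimizer (Rrob P Z eta sigma alpha1 eps) w1 b1 ->
        is_minimizer (Rrob P Z eta sigma alpha2 eps) w2 b2 ->
        (Rrob_pos P Z eta sigma eps w2 b2 < Rrob_pos P Z eta sigma eps w1 b1)%E)).
Proof.
split=> [alpha a1|alpha1 alpha2 a1 a12].
  split; last exact: Rrob_pos_minimizer (ltW heps0) hepseta.
  (* The natural claim is the robust one at radius 0, so the argument of [crit] is first written as
     a difference with 0. *)
  rewrite -[X in crit d sigma X]subr0 -Rrob0 -Rrob_pos0.
  exact: Rrob_pos_minimizer.
split=> w1 b1 w2 b2.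
  rewrite -!Rrob0 -Rrob_pos0.
  exact: Rrob_pos_minimizer_decr.
by apply: Rrob_pos_minimizer_decr => //; exact: ltW.
Qed.
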